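(* Let $n,m,u,v,d$ be nonnegative integers with $d\ge 1$ and $u+v<m-1$. Let $\mathbf{p}_0,\dots,\mathbf{p}_n\in\mathbb{R}^d$, let $\omega_0,\dots,\omega_n>0$, put $\mathbf{P}_i=\omega_i\mathbf{p}_i$, and let $$\mathbf{x}(t)=\frac{\sum_{i=0}^n \omega_i\mathbf{p}_iB_i^n(t)}{\sum_{i=0}^n\omega_iB_i^n(t)}=\frac{\sum_{i=0}^n \mathbf{P}_iB_i^n(t)}{\sum_{i=0}^n\omega_iB_i^n(t)},\qquad t\in[0,1],$$ be a rational Bézier curve of degree $n$. Let $$\tilde{\mathbf{y}}(t)=\sum_{i=0}^u\mathbf{q}_iB_i^m(t)+t^{u+1}(1-t)^{v+1}\sum_{j=0}^{M}\tilde{\mathbf{q}}_jJ_j^{(u+1,v+1)}(2t-1)+\sum_{i=m-v}^m\mathbf{q}_iB_i^m(t),\qquad M=m-(u+v+2),$$ be a Bernstein-Jacobi hybrid curve with constrained control points $\mathbf{q}_i\in\mathbb{R}^d$ ($0\le i\le u$ or $m-v\le i\le m$) and Jacobi control points $\tilde{\mathbf{q}}_j\in\mathbb{R}^d$ ($0\le j\le M$). If $$\mathbf{q}_r=\frac{1}{\omega_0\binom{m}{r}}\left[\binom{n}{r}\Delta^r\mathbf{P}_0-\sum_{i=0}^{r-1}(-1)^{r+i}\binom{m+n}{r}\binom{r}{i}\mathbf{C}_i-\sum_{i=\max(0,r-n)}^{r-1}\binom{m}{i}\binom{n}{r-i}\omega_{r-i}\mathbf{q}_i\right],\quad r=0,\dots,u,$$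 and $$\mathbf{q}_{m-s}=\frac{(-1)^s}{\omega_n\binom{m}{s}}\left[\binom{n}{s}\Delta^s\mathbf{P}_{n-s}-\sum_{i=1}^{s}(-1)^{s+i}\binom{m+n}{s}\binom{s}{i}\mathbf{C}_{m+n-s+i}-\sum_{i=1}^{\min(s,n)}(-1)^s\binom{m}{s-i}\binom{n}{i}\omega_{n-i}\mathbf{q}_{m-s+i}\right],\quad s=0,\dots,v,$$ where $$\mathbf{C}_k=\sum_{j=\max(0,k-n)}^{\min(m,k)}\frac{\binom{m}{j}\binom{n}{k-j}}{\binom{m+n}{k}}\,\omega_{k-j}\,\mathbf{q}_j ,$$ then $\mathbf{x}$ and $\tilde{\mathbf{y}}$ satisfy $C^{(u,v)}$-continuity.
   Context: $B_i^n(t)=\binom{n}{i}t^i(1-t)^{n-i}$ are the Bernstein basis functions. Convention: $\binom{i}{j}=0$ if $i<j$; in particular, when $r>n$ (resp. $s>n$) the term $\binom{n}{r}\Delta^r\mathbf{P}_0$ (resp. $\binom{n}{s}\Delta^s\mathbf{P}_{n-s}$) is read as $0$. Empty sums are $0$. $\Delta$ is the forward difference operator on indices: $\Delta^r\mathbf{P}_k=\sum_{i=0}^r(-1)^{r+i}\binom{r}{i}\mathbf{P}_{k+i}$. $J_j^{(a,b)}$ denotes the Jacobi polynomial of degree $j$; explicitly, for integers $r,s\ge0$, $J_k^{(r+1,s+1)}(2t-1)=\sum_{i=0}^k(-1)^{k+i}\frac{\binom{k+r+1}{i}\binom{k+s+1}{k-i}}{\binom{k}{i}}B_i^k(t)$.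 $C^{(u,v)}$-continuity of $\mathbf{x}$ and $\tilde{\mathbf{y}}$ means that $\mathbf{x}^{(r)}(0)=\tilde{\mathbf{y}}^{(r)}(0)$ for $r=0,\dots,u$ and $\mathbf{x}^{(s)}(1)=\tilde{\mathbf{y}}^{(s)}(1)$ for $s=0,\dots,v$. The quantities $\mathbf{C}_k$ occurring in the formula for $\mathbf{q}_r$ (with $k\le r-1$) involve only $\mathbf{q}_0,\dots,\mathbf{q}_{r-1}$, and those occurring in the formula for $\mathbf{q}_{m-s}$ (with $k\ge m+n-s+1$) involve only $\mathbf{q}_{m-s+1},\dots,\mathbf{q}_m$, so the formulas are recursive and involve only the constrained control points. *)

(* Defs.v *)
From mathcomp Require Import all_boot all_order all_algebra.
From mathcomp Require Import all_classical all_reals all_analysis.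

Set Implicit Arguments.
Unset Strict Implicit.
Unset Printing Implicit Defensive.

Import Order.TTheory GRing.Theory Num.Theory.
Import numFieldNormedType.Exports.

Local Open Scope classical_set_scope.
Local Open Scope ring_scope.

(* Finite families (weights, control points) are represented by functions on
   nat; values at indices outside the range of the family are irrelevant. *)

Definition bernstein (R : realType) (n i : nat) (t : R) : R :=
  'C(n, i)%:R * t ^+ i * (1 - t) ^+ (n - i).

(* Jacobi polynomial of degree k with natural parameters a, b, given by its
   Bernstein expansion in t = (x + 1) / 2; it takes the value 'C(k + a, k)
   at x = 1. *)
Definition jacobi (R : realType) (a b k : nat) (x : R) : R :=
  \sum_(0 <= i < k.+1)
    (-1) ^+ (k + i) * ('C(k + a, i)%:R * 'C(k + b, k - i)%:R / 'C(k, i)%:R)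
    * bernstein k i ((x + 1) / 2%:R).

Definition fdiff (R : realType) (d r : nat) (P : nat -> 'rV[R]_d) (k : nat)
  : 'rV[R]_d :=
  \sum_(0 <= i < r.+1) ((-1) ^+ (r + i) * 'C(r, i)%:R) *: P (k + i)%N.

(* On [0, 1] the denominator is positive when all weights are. *)
Definition rational_bezier (R : realType) (d n : nat) (w : nat -> R)
    (p : nat -> 'rV[R]_d) (t : R) : 'rV[R]_d :=
  (\sum_(0 <= i < n.+1) w i * bernstein n i t)^-1 *:
  \sum_(0 <= i < n.+1) bernstein n i t *: (w i *: p i).

(* q gives the constrained control points (indices <= u and >= m - v),
   qt the Jacobi control points. *)
Definition bernstein_jacobi (R : realType) (d m u v : nat)
    (q qt : nat -> 'rV[R]_d) (t : R) : 'rV[R]_d :=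
  \sum_(0 <= i < u.+1) bernstein m i t *: q i
  + (t ^+ u.+1 * (1 - t) ^+ v.+1) *:
      \sum_(0 <= j < (m - (u + v + 2)).+1)
         jacobi u.+1 v.+1 j (2%:R * t - 1) *: qt j
  + \sum_(m - v <= i < m.+1) bernstein m i t *: q i.

(* The truncated subtraction k - n is max(0, k - n). *)
Definition prodC (R : realType) (d m n : nat) (w : nat -> R)
    (q : nat -> 'rV[R]_d) (k : nat) : 'rV[R]_d :=
  \sum_(k - n <= j < (minn m k).+1)
    ('C(m, j)%:R * 'C(n, k - j)%:R / 'C(m + n, k)%:R * w (k - j)%N) *: q j.

(* Since f^`(r) is total (its value is meaningless where the derivative does
   not exist), the existence of the derivatives is required separately. *)
Definition nderivable (R : realType) (d : nat) (f : R -> 'rV[R]_d) (r : nat)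
    (a : R) : Prop :=
  forall k : nat, (k < r)%N -> \forall t \near a, derivable (f^`(k))%classic t 1.

Definition same_derivative (R : realType) (d : nat) (x y : R -> 'rV[R]_d)
    (r : nat) (a : R) : Prop :=
  [/\ nderivable x r a, nderivable y r a & (x^`(r))%classic a = (y^`(r))%classic a].

(* The curves are the expressions in t on a neighbourhood of [0, 1], so that
   the derivatives at the endpoints are two-sided; they coincide with the
   one-sided derivatives of the restrictions to [0, 1]. *)
Definition Cuv_continuity (R : realType) (d u v : nat)
    (x y : R -> 'rV[R]_d) : Prop :=
  (forall r : nat, (r <= u)%N -> same_derivative x y r 0) /\
  (forall s : nat, (s <= v)%N -> same_derivative x y s 1).

(* Main.v *)
Require Import Defs.
From mathcomp Require Import all_boot all_order all_algebra.
From mathcomp Require Import all_classical all_reals all_analysis.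
From mathcomp Require Import ring zify.
Set Implicit Arguments.
Unset Strict Implicit.
Unset Printing Implicit Defensive.
Import Order.TTheory GRing.Theory Num.Theory.
Import numFieldNormedType.Exports.
Local Open Scope ring_scope.

(* Write x = P / W and y = Y / 1 as quotients of polynomials. If
   (X - a)^(r+1) divides the cross difference P - W Y, then (X - a)^r divides
   the cross difference of the formal derivatives of the quotients, so by
   induction the r-th derivatives of x and y agree at a. It remains to see that
   X^(u+1) and (1 - X)^(v+1) divide W Y - P. The Jacobi part of Y is irrelevant
   for this, and the Bernstein coefficients of the product of W with the
   Bernstein part are the C_k. The coefficient of X^r in a Bernstein combination
   of degree N with coefficients c is 'C(N, r) Delta^r c_0, so divisibility by
   X^(u+1) says 'C(m + n, r) Delta^r C_0 = 'C(n, r) Delta^r P_0 for r <= u,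
   which is the recursion for q_r. The substitution X -> 1 - X reverses the
   coefficients and gives the other endpoint. *)

(** * Rational curves as unreduced pairs of polynomials, and their derivatives *)

Definition ratfun (R : realType) (d : nat) (f : 'rV[{poly R}]_d * {poly R}) (t : R) : 'rV[R]_d :=
  f.2.[t]^-1 *: map_mx (horner^~ t) f.1.

(** Fractions stay unreduced: the denominators of the iterates are powers of the first one, so they
    are nonzero wherever it is. *)
Definition quot_deriv (R : realType) (d : nat) (f : 'rV[{poly R}]_d * {poly R}) :=
  (f.2 *: map_mx deriv f.1 - f.2^`() *: f.1, f.2 ^+ 2).

Lemma near_horner_neq0 (R : realType) (p : {poly R}) (a : R) :
  p.[a] != 0 -> \forall t \near a, p.[t] != 0.
Proof.
by move=> pa; apply: (cvgr_neq0 _ (@continuous_horner _ p a) pa).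
Qed.

Lemma is_derive_ratfun (R : realType) (d : nat) (f : 'rV[{poly R}]_d * {poly R})
    (t : R) :
  f.2.[t] != 0 -> is_derive t 1 (ratfun f) (ratfun (quot_deriv f) t).
Proof.
move=> ft.
have entry i j : (fun x => ratfun f x i j) = (fun x => f.2.[x]^-1) * horner (f.1 i j).
  by apply/funext => x; rewrite !mxE.
have dV : derivable (fun x => f.2.[x]^-1) t 1 := derivableV ft (@derivable_horner _ _ _).
have dM : derivable (ratfun f) t 1.
  apply/derivable_mxP => i j; rewrite entry.
  exact: derivableM dV (@derivable_horner _ _ _).
apply: DeriveDef => //; rewrite derive_mx //; apply/matrixP => i j.
rewrite !mxE entry (deriveM dV (@derivable_horner _ _ _)).
rewrite (deriveV ft (@derivable_horner _ _ _)).
rewrite -!derive1E -!derivE !hornerE /= /GRing.scale /=.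
by field.
Qed.

Lemma near_derive1 (R : realType) (V : normedModType R) (f g : R -> V) (a : R) :
  (\forall t \near a, f t = g t) ->
  \forall t \near a, (f^`()%classic t = g^`()%classic t).
Proof.
(* [near_join] gives equality on a neighbourhood of each [t] near [a], which is what the derivative
   at [t] depends on. *)
move=> /near_join; apply: filterS => t fg.
by rewrite !derive1E; exact: near_eq_derive.
Qed.

Lemma iter_quot_deriv_neq0 (R : realType) (d : nat) (f : 'rV[{poly R}]_d * {poly R})
    (a : R) k : f.2.[a] != 0 -> (iter k (@quot_deriv R d) f).2.[a] != 0.
Proof. by move=> fa; elim: k => //= k IH; rewrite !hornerE mulf_neq0. Qed.

(** The equality is kept on a neighbourhood of [a]: equality at [a] alone could not be
    differentiated in the induction. *)
Lemma derive1n_ratfun (R : realType) (d : nat) (f : 'rV[{poly R}]_d * {poly R})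
    (a : R) k : f.2.[a] != 0 ->
  \forall t \near a, (derive1n k (ratfun f) t = ratfun (iter k (@quot_deriv R d) f) t).
Proof.
move=> fa; elim: k => [|k IH]; first exact: (@filterE _ (nbhs a) _ _ (fun _ => erefl)).
have := near_horner_neq0 (iter_quot_deriv_neq0 k fa).
apply: filterS2 (near_derive1 IH) => t ht ft.
by rewrite derive1nS ht derive1E (@derive_val _ _ _ _ _ _ _ (is_derive_ratfun ft)).
Qed.

Lemma nderivable_ratfun (R : realType) (d : nat) (f : 'rV[{poly R}]_d * {poly R})
    (a : R) r : f.2.[a] != 0 -> nderivable (ratfun f) r a.
Proof.
move=> fa k _; have /near_join := derive1n_ratfun k fa.
apply: filterS2 (near_horner_neq0 (iter_quot_deriv_neq0 k fa)) => t ft ht.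
apply: near_eq_derivable (@ex_derive _ _ _ _ _ _ _ (is_derive_ratfun ft)).
by apply: filterS ht => s ->.
Qed.

(** * Contact of two quotients at a point *)

Definition cross (R : realType) (d : nat) (f g : 'rV[{poly R}]_d * {poly R}) :=
  g.2 *: f.1 - f.2 *: g.1.

Lemma dvdp_deriv (R : realType) (a : R) k (p : {poly R}) :
  ('X - a%:P) ^+ k.+1 %| p -> ('X - a%:P) ^+ k %| p^`().
Proof.
move=> /dvdpP[c ->]; rewrite derivM deriv_exp derivXsubC mul1r /=.
apply: dvdp_add; last by rewrite -mulr_natl mulrA; exact: dvdp_mull.
by apply: dvdp_mull; exact: dvdp_exp2l.
Qed.

(** [cross f g] is the numerator of the difference of the two quotients over [f.2 * g.2]; this is
    the quotient rule for that difference. *)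
Lemma cross_quot_deriv (R : realType) (d : nat) (f g : 'rV[{poly R}]_d * {poly R}) j :
  cross (quot_deriv f) (quot_deriv g) 0 j =
  (cross f g 0 j)^`() * (f.2 * g.2) - cross f g 0 j * (f.2 * g.2)^`().
Proof. by rewrite !mxE derivB !derivM /quot_deriv /=; ring. Qed.

Lemma ratfun_contact (R : realType) (d : nat) (f g : 'rV[{poly R}]_d * {poly R})
    (a : R) r :
  f.2.[a] != 0 -> g.2.[a] != 0 ->
  (forall j, ('X - a%:P) ^+ r.+1 %| cross f g 0 j) ->
  same_derivative (ratfun f) (ratfun g) r a.
Proof.
move=> fa ga dvd; split; [exact: nderivable_ratfun..|].
rewrite (nbhs_singleton (derive1n_ratfun r fa)) (nbhs_singleton (derive1n_ratfun r ga)).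
(* [f] and [g] stay general because the induction passes to their derived pairs, losing one order of
   vanishing each time. *)
elim: r f g fa ga dvd => [|r IH] f g fa ga dvd.
  apply/rowP => j; rewrite !mxE /=; apply/eqP.
  move: (dvd j); rewrite expr1 dvdp_XsubCl /root !mxE !hornerE subr_eq0 => /eqP e.
  by rewrite !(mulrC _^-1) eqr_div // mulrC e mulrC.
rewrite !iterSr; apply: IH; rewrite ?hornerE ?mulf_neq0 // => j.
rewrite cross_quot_deriv dvdp_sub // dvdp_mulr //; first exact: dvdp_deriv.
exact: dvdp_trans (dvdp_exp2l _ (leqnSn _)) (dvd j).
Qed.

(** * Bernstein polynomials and their monomial coefficients *)

Definition bernp (R : realType) (n i : nat) : {poly R} :=
  'C(n, i)%:R *: ('X^i * (1 - 'X) ^+ (n - i)).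

Definition bezier_row (R : realType) (d n : nat) (c : nat -> 'rV[R]_d) : 'rV[{poly R}]_d :=
  \row_j \sum_(0 <= i < n.+1) c i 0 j *: bernp R n i.

Lemma horner_bernp (R : realType) n i (t : R) : (bernp R n i).[t] = bernstein n i t.
Proof. by rewrite /bernp !hornerE. Qed.

(** For [r <= n] both sides are the trinomial coefficient n! / (k! (r - k)! (n - r)!); for [r > n]
    both are zero. *)
Lemma mul_bin_trinomial n k r :
  (k <= r)%N -> ('C(n, k) * 'C(n - k, r - k) = 'C(n, r) * 'C(r, k))%N.
Proof.
move=> kr; have [rn|nr] := leqP r n; last first.
  rewrite [in RHS]bin_small //; have [kn|nk] := leqP k n; last by rewrite bin_small.
  by rewrite ['C(n - k, _)]bin_small ?muln0 //; lia.
apply/eqP; rewrite -(eqn_pmul2r (_ : 0 < k`! * (r - k)`! * (n - r)`!)%N); last first.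
  by rewrite !muln_gt0 !fact_gt0.
have e1 := bin_fact (leq_trans kr rn); have e2 := bin_fact rn.
have e3 := bin_fact kr; have e4 : (r - k <= n - k)%N by lia.
have := bin_fact e4; rewrite (_ : n - k - (r - k) = n - r)%N; last by lia.
move=> e5; apply/eqP; transitivity n`!.
  by rewrite -e1 -e5; ring.
by rewrite -e2 -e3; ring.
Qed.

Lemma coef_1BX_exp (R : nzRingType) n i :
  ((1 - 'X : {poly R}) ^+ n)`_i = (-1) ^+ i * 'C(n, i)%:R.
Proof.
elim: n i => [|n IH] [|i].
- by rewrite expr0 coef1 expr0 mul1r.
- by rewrite expr0 coef1 bin0n mulr0.
- by rewrite exprS mulrBl mul1r coefB coefXM /= subr0 IH !bin0.
- rewrite exprS mulrBl mul1r coefB coefXM /= !IH binS natrD mulrDr exprS.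
  by rewrite !mulN1r !mulNr.
Qed.

(** The trinomial identity isolates ['C(n, r)]; what remains is the weight of index [k] in an [r]-th
    forward difference. *)
Lemma coef_bernp (R : realType) n k r :
  (bernp R n k)`_r = 'C(n, r)%:R * ((-1) ^+ (r + k) * 'C(r, k)%:R).
Proof.
rewrite coefZ coefXnM; case: ltnP => [rk|kr].
  by rewrite (bin_small rk) !mulr0.
rewrite coef_1BX_exp mulrCA -natrM mul_bin_trinomial // natrM.
rewrite -signr_odd oddB // -oddD signr_odd; ring.
Qed.

Lemma coef_bezier_row (R : realType) d n (c : nat -> 'rV[R]_d) j r :
  (bezier_row n c 0 j)`_r = ('C(n, r)%:R *: fdiff r c 0) 0 j.
Proof.
(* Beyond the degree both sides vanish. Otherwise the Bernstein sum is cut after index [r], as later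
   terms carry a zero ['C(r, i)]. *)
rewrite [RHS]mxE [in LHS]mxE coef_sum; have [rn|nr] := leqP r n; last first.
  rewrite (bin_small nr) mul0r big1 // => i _.
  by rewrite coefZ coef_bernp (bin_small nr) mul0r mulr0.
rewrite (@big_cat_nat _ _ _ r.+1) //=.
rewrite [X in _ + X]big_nat_cond [X in _ + X]big1 ?addr0; last first.
  by move=> i /andP[/andP[ri _] _]; rewrite coefZ coef_bernp (bin_small ri) !mulr0.
rewrite summxE mulr_sumr; apply: eq_bigr => i _.
by rewrite coefZ coef_bernp mxE; ring.
Qed.

Lemma dvdp_Xn_coef (R : realType) k (p : {poly R}) :
  (forall i, (i < k)%N -> p`_i = 0) -> 'X^k %| p.
Proof.
move=> pk; rewrite -(poly_take_drop k p) (_ : take_poly k p = 0) ?add0r ?dvdp_mull //.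
by apply/polyP => i; rewrite coef_take_poly coef0; case: ifP => // /pk.
Qed.

(** Comparing monomial coefficients lets the degrees [N] and [n] differ without degree elevation. *)
Lemma dvdp_bezier_row0 (R : realType) d N n (c b : nat -> 'rV[R]_d) u j :
  (forall r, (r <= u)%N ->
     'C(N, r)%:R *: fdiff r c 0 = 'C(n, r)%:R *: fdiff r b 0) ->
  'X^(u.+1) %| bezier_row N c 0 j - bezier_row n b 0 j.
Proof.
move=> h; apply: dvdp_Xn_coef => i; rewrite ltnS => /h e.
by rewrite coefB !coef_bezier_row e subrr.
Qed.

(** * Reversal of the parameter *)

Lemma bernp_comp (R : realType) n i :
  (i <= n)%N -> bernp R n i \Po (1 - 'X) = bernp R n (n - i).
Proof.
move=> ni; rewrite /bernp comp_polyZ comp_polyM !rmorphXn /= rmorphB rmorph1 /=.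
by rewrite comp_polyX subKr mulrC subKn // bin_sub.
Qed.

Lemma bezier_row_comp (R : realType) d n (c : nat -> 'rV[R]_d) j :
  bezier_row n c 0 j \Po (1 - 'X) = bezier_row n (fun i => c (n - i)%N) 0 j.
Proof.
rewrite !mxE [RHS]big_nat_rev /= rmorph_sum /=; apply: eq_big_nat => i /andP[_ ni].
by rewrite linearZ /= bernp_comp // add0n subSS subKn.
Qed.

Lemma fdiff_rev (R : realType) d n (c : nat -> 'rV[R]_d) s :
  (s <= n)%N -> fdiff s (fun i => c (n - i)%N) 0 = (-1) ^+ s *: fdiff s c (n - s).
Proof.
move=> sn; rewrite /fdiff big_nat_rev scaler_sumr /=; apply: eq_big_nat => i /andP[_ si].
rewrite add0n subSS bin_sub // scalerA add0n mulrA -exprD addnA addnn.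
(* The two sign exponents are [s.*2 - i] and [s.*2 + i], which have equal parity. *)
rewrite (_ : s + (s - i) = s.*2 - i)%N; last by lia.
congr (_ * _ *: c _); last by lia.
rewrite (_ : s.*2 + i = s.*2 - i + i.*2)%N; last by lia.
by rewrite exprD -[X in _ = _ * X]signr_odd odd_double mulr1.
Qed.

(** For [s > n] the difference [n - s] truncates to [0] and reversal of differences may fail, but
    the binomial factor is then zero. *)
Lemma bin_fdiff_rev (R : realType) d n (c : nat -> 'rV[R]_d) s :
  'C(n, s)%:R *: fdiff s (fun i => c (n - i)%N) 0 =
  (-1) ^+ s *: ('C(n, s)%:R *: fdiff s c (n - s)).
Proof.
have [sn|ns] := leqP s n; first by rewrite fdiff_rev // scalerA mulrC -scalerA.
by rewrite bin_small // !scale0r scaler0.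
Qed.

Lemma dvdp_bezier_row1 (R : realType) d N n (c b : nat -> 'rV[R]_d) v j :
  (forall s, (s <= v)%N ->
     'C(N, s)%:R *: fdiff s c (N - s) = 'C(n, s)%:R *: fdiff s b (n - s)) ->
  (1 - 'X) ^+ v.+1 %| bezier_row N c 0 j - bezier_row n b 0 j.
Proof.
(* Substituting 1 - X is an involution, so dividend and divisor are both written as images under it,
   which reduces the claim to the endpoint 0. *)
move=> h; have revK (p : {poly R}) : p \Po (1 - 'X) \Po (1 - 'X) = p.
  by rewrite -comp_polyA rmorphB rmorph1 /= comp_polyX subKr comp_polyXr.
rewrite -[X in _ %| X]revK (_ : _ ^+ _ = 'X^(v.+1) \Po (1 - 'X)); last first.
  by rewrite rmorphXn /= comp_polyX.
apply: dvdp_comp_poly; rewrite rmorphB /= !bezier_row_comp.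
by apply: dvdp_bezier_row0 => s /h e; rewrite !bin_fdiff_rev e.
Qed.

(** * Products of Bernstein combinations *)

Lemma bernpM (R : realType) m n j l : (j <= m)%N -> (l <= n)%N ->
  bernp R m j * bernp R n l =
  ('C(m, j)%:R * 'C(n, l)%:R / 'C(m + n, j + l)%:R) *: bernp R (m + n) (j + l).
Proof.
move=> jm ln; rewrite /bernp scalerA divfK; last first.
  by rewrite pnatr_eq0 -lt0n bin_gt0 leq_add.
rewrite -scalerAl -scalerAr scalerA; congr (_ *: _).
rewrite (_ : m + n - (j + l) = (m - j) + (n - l))%N; last by lia.
by rewrite !exprD; ring.
Qed.

Lemma sum_nat_convolution (V : nmodType) (F : nat -> nat -> V) m n :
  \sum_(0 <= j < m.+1) \sum_(0 <= l < n.+1) F j l =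
  \sum_(0 <= k < (m + n).+1) \sum_(k - n <= j < (minn m k).+1) F j (k - j)%N.
Proof.
(* With k = j + l the filter encodes j <= k <= j + n; a range of [k] independent of [j] allows the
   sums to be exchanged. *)
transitivity (\sum_(0 <= j < m.+1)
    \sum_(0 <= k < (m + n).+1 | (k < n.+1 + j)%N && (j <= k)%N) F j (k - j)%N).
  apply: eq_big_nat => j /andP[_ jm].
  rewrite -(@big_nat_widenl _ _ _ j 0 _ (fun k => k < n.+1 + j)%N) //.
  rewrite -(@big_nat_widen _ _ _ j (n.+1 + j) _ xpredT); last by lia.
  rewrite -{2}[j]add0n big_addn addnK.
  by apply: eq_bigr => i _; rewrite addnK.
rewrite (exchange_big_dep xpredT) //=; apply: eq_big_nat => k /andP[_ kmn].
rewrite [RHS](@big_nat_widen _ _ _ _ _ m.+1); last by lia.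
rewrite [RHS](@big_nat_widenl _ _ _ _ 0) //.
rewrite big_nat_cond [RHS]big_nat_cond; apply: eq_bigl => j; lia.
Qed.

Lemma bezier_row_prodC (R : realType) d m n (w : nat -> R) (q : nat -> 'rV[R]_d) :
  (\sum_(0 <= i < n.+1) w i *: bernp R n i) *: bezier_row m q =
  bezier_row (m + n) (prodC m n w q).
Proof.
apply/rowP => j; rewrite !mxE mulr_suml.
transitivity (\sum_(0 <= i < m.+1) \sum_(0 <= l < n.+1)
   (q i 0 j * w l) *: (bernp R m i * bernp R n l)).
  rewrite exchange_big /=; apply: eq_bigr => l _; rewrite mulr_sumr.
  apply: eq_bigr => i _; rewrite -scalerAl -scalerAr scalerA.
  by rewrite [w l * _]mulrC [bernp R n l * _]mulrC.
rewrite sum_nat_convolution; apply: eq_bigr => k _; rewrite summxE scaler_suml.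
apply: eq_big_nat => i /andP[ki ik].
rewrite bernpM; [|lia..]; rewrite subnKC; last lia.
by rewrite scalerA mxE; congr (_ *: _); ring.
Qed.

(** * The recursions as conditions on differences of the product coefficients *)

Lemma bin_prodC_low (R : realType) d m n (w : nat -> R) (q : nat -> 'rV[R]_d) r :
  (r <= m)%N ->
  'C(m + n, r)%:R *: prodC m n w q r =
  \sum_(r - n <= i < r) ('C(m, i)%:R * 'C(n, r - i)%:R * w (r - i)%N) *: q i
  + (w 0%N * 'C(m, r)%:R) *: q r.
Proof.
move=> rm; have Cr : 'C(m + n, r)%:R != 0 :> R.
  by rewrite pnatr_eq0 -lt0n bin_gt0; lia.
rewrite /prodC (minn_idPr rm) big_nat_recr ?leq_subr //= scalerDr scaler_sumr.
congr (_ + _); last by rewrite scalerA subnn bin0; congr (_ *: _); field.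
by apply: eq_bigr => i _; rewrite scalerA; congr (_ *: _); field.
Qed.

Lemma bin_prodC_high (R : realType) d m n (w : nat -> R) (q : nat -> 'rV[R]_d) s :
  (s <= m)%N ->
  'C(m + n, s)%:R *: prodC m n w q (m + n - s) =
  (w n * 'C(m, s)%:R) *: q (m - s)%N
  + \sum_(1 <= i < (minn s n).+1)
      ('C(m, s - i)%:R * 'C(n, i)%:R * w (n - i)%N) *: q (m - s + i)%N.
Proof.
move=> sm; have Cs : 'C(m + n, s)%:R != 0 :> R.
  by rewrite pnatr_eq0 -lt0n bin_gt0; lia.
(* With j = m - s + i the bounds become 0 <= i <= min(s, n), and the control point solved for is the
   term i = 0. *)
rewrite /prodC (_ : m + n - s - n = 0 + (m - s))%N; last by lia.
rewrite big_addn (_ : _ - (m - s) = (minn s n).+1)%N; last by lia.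
have sub_mid i : (i <= minn s n)%N -> (m + n - s - (i + (m - s)) = n - i)%N by lia.
rewrite big_ltn // scalerDr scaler_sumr; congr (_ + _).
  rewrite sub_mid // add0n subn0 binn bin_sub // bin_sub; last by lia.
  by rewrite scalerA; congr (_ *: _); field.
apply: eq_big_nat => i /andP[_ ile]; rewrite sub_mid // scalerA [(m - s + i)%N]addnC.
have -> : 'C(m, i + (m - s)) = 'C(m, s - i).
  by rewrite -[RHS]bin_sub; [congr binomial|]; lia.
rewrite bin_sub; last by lia.
rewrite bin_sub; last by lia.
by congr (_ *: _); field.
Qed.

(** After scaling, the last term of the difference is ['C(m + n, r)] times [prodC] at [r], and it
    contains [q r] with factor [w 0 * 'C(m, r)]. The two sums subtracted in the recursion are the
    other terms of the difference and of that [prodC]. *)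
Lemma prodC_fdiff_left (R : realType) d m n (w : nat -> R) (q P : nat -> 'rV[R]_d) r :
  (r <= m)%N -> w 0%N != 0 ->
  q r = (w 0%N * 'C(m, r)%:R)^-1 *:
        ('C(n, r)%:R *: fdiff r P 0
         - \sum_(0 <= i < r)
             ((-1) ^+ (r + i) * 'C(m + n, r)%:R * 'C(r, i)%:R)
               *: prodC m n w q i
         - \sum_(r - n <= i < r)
             ('C(m, i)%:R * 'C(n, r - i)%:R * w (r - i)%N) *: q i) ->
  'C(m + n, r)%:R *: fdiff r (prodC m n w q) 0 = 'C(n, r)%:R *: fdiff r P 0.
Proof.
move=> rm w0 qE; have Cr : 'C(m, r)%:R != 0 :> R by rewrite pnatr_eq0 -lt0n bin_gt0.
rewrite [in LHS]/fdiff big_nat_recr //= scalerDr [X in X + _]scaler_sumr.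
rewrite addnn -signr_odd odd_double binn mulr1 scale1r bin_prodC_low //.
rewrite qE scalerA mulfV ?mulf_neq0 // scale1r.
under eq_bigr => i _ do rewrite scalerA mulrA [_%:R * (-1) ^+ _]mulrC.
by rewrite [_ + (_ - _)]addrC subrK addrC subrK.
Qed.

(** Here the newest point sits in the first term of the difference, with sign (-1)^s; the sign in
    the recursion cancels it. *)
Lemma prodC_fdiff_right (R : realType) d m n (w : nat -> R) (q P : nat -> 'rV[R]_d) s :
  (s <= m)%N -> w n != 0 ->
  q (m - s)%N = ((-1) ^+ s / (w n * 'C(m, s)%:R)) *:
        ('C(n, s)%:R *: fdiff s P (n - s)
         - \sum_(1 <= i < s.+1)
             ((-1) ^+ (s + i) * 'C(m + n, s)%:R * 'C(s, i)%:R)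
               *: prodC m n w q (m + n - s + i)
         - \sum_(1 <= i < (minn s n).+1)
             ((-1) ^+ s * 'C(m, s - i)%:R * 'C(n, i)%:R * w (n - i)%N)
               *: q (m - s + i)%N) ->
  'C(m + n, s)%:R *: fdiff s (prodC m n w q) (m + n - s) =
  'C(n, s)%:R *: fdiff s P (n - s).
Proof.
move=> sm wn qE; have Cs : 'C(m, s)%:R != 0 :> R by rewrite pnatr_eq0 -lt0n bin_gt0.
rewrite [in LHS]/fdiff big_ltn // scalerDr [X in _ + X]scaler_sumr.
rewrite !addn0 bin0 mulr1 scalerA mulrC -scalerA bin_prodC_high //.
rewrite qE scalerA mulrCA mulfV ?mulf_neq0 // mulr1 scalerDr scalerA -expr2 sqrr_sign.
rewrite scale1r [in X in _ + X + _]scaler_sumr.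
under [X in _ + X + _]eq_bigr => i _ do rewrite scalerA !mulrA.
rewrite subrK.
under [X in _ + X]eq_bigr => i _ do rewrite scalerA mulrA [_%:R * (-1) ^+ _]mulrC.
by rewrite subrK.
Qed.

(** * The two curves as quotients of polynomials *)

Definition bernstein_jacobi_row (R : realType) (d m u v : nat)
    (q qt : nat -> 'rV[R]_d) : 'rV[{poly R}]_d :=
  \row_j (\sum_(0 <= i < u.+1) q i 0 j *: bernp R m i
  + 'X^(u.+1) * (1 - 'X) ^+ v.+1 *
      \sum_(0 <= k < (m - (u + v + 2)).+1)
         qt k 0 j *: \sum_(0 <= i < k.+1)
           ((-1) ^+ (k + i) * ('C(k + u.+1, i)%:R * 'C(k + v.+1, k - i)%:R / 'C(k, i)%:R))
             *: bernp R k i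
  + \sum_(m - v <= i < m.+1) q i 0 j *: bernp R m i).

(** The denominator [1] puts the hybrid curve in the same class as the rational one, so that
    [ratfun_contact] can compare them. *)
Lemma bernstein_jacobi_ratfun (R : realType) (d m u v : nat)
    (q qt : nat -> 'rV[R]_d) :
  bernstein_jacobi m u v q qt = ratfun (bernstein_jacobi_row m u v q qt, 1).
Proof.
apply/funext => t; apply/rowP => j; rewrite !mxE /= !hornerE invr1 mul1r !summxE.
rewrite !horner_sum; congr (_ + _ * _ + _).
- by apply: eq_bigr => i _; rewrite mxE hornerZ horner_bernp mulrC.
- apply: eq_bigr => k _; rewrite mxE hornerZ horner_sum mulrC; congr (_ * _).
  (* The Jacobi argument 2t - 1 is mapped back by (x + 1) / 2 to t. *)
  apply: eq_bigr => i _; rewrite hornerZ horner_bernp subrK.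
  by rewrite [_ * t]mulrC mulfK // pnatr_eq0.
- by apply: eq_bigr => i _; rewrite mxE hornerZ horner_bernp mulrC.
Qed.

Lemma rational_bezier_ratfun (R : realType) (d n : nat) (w : nat -> R)
    (p : nat -> 'rV[R]_d) :
  rational_bezier n w p =
  ratfun (bezier_row n (fun i => w i *: p i), \sum_(0 <= i < n.+1) w i *: bernp R n i).
Proof.
apply/funext => t; apply/rowP => j; rewrite !mxE /= summxE !horner_sum.
congr (_^-1 * _); apply: eq_bigr => i _; rewrite ?mxE hornerZ horner_bernp //.
by rewrite mulrC.
Qed.

(* bezier_row also involves the values q i for u < i < m - v, which are arbitrary:
   their Bernstein polynomials are multiples of the divisor. *)
Lemma dvdp_bernstein_jacobi_row (R : realType) (d m u v : nat)
    (q qt : nat -> 'rV[R]_d) j :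
  (u + v < m - 1)%N ->
  'X^(u.+1) * (1 - 'X) ^+ v.+1 %|
    bernstein_jacobi_row m u v q qt 0 j - bezier_row m q 0 j.
Proof.
move=> uvm; rewrite !mxE.
have addE (a b c e : {poly R}) : a + b + c - (a + (e + c)) = b - e by ring.
rewrite [X in _ + _ + _ - X](@big_cat_nat _ _ _ u.+1) //=; last by lia.
rewrite [X in _ - (_ + X)](@big_cat_nat _ _ _ (m - v)) //=; [|lia..].
rewrite addE.
apply: dvdp_sub; first exact: dvdp_mulr.
rewrite big_nat_cond; apply: (big_ind (fun p => _ %| p)) => [|x y|i].
- exact: dvdp0.
- exact: dvdp_add.
move=> /andP[/andP[ui iv] _].
rewrite /bernp scalerA -mul_polyC; apply: dvdp_mull.
by apply: dvdp_mul; apply: dvdp_exp2l; lia.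
Qed.

(** Contact is stated with X - 1 and parameter reversal yields 1 - X; the two differ by a sign. *)
Lemma dvdp_XB1_1BX (R : realType) k : ('X - 1%:P) ^+ k %| (1 - 'X : {poly R}) ^+ k.
Proof. by rewrite polyC1 -[1 - 'X]opprB [(- _) ^+ _]exprNn; exact: dvdp_mull. Qed.

(** * Assembly at the two endpoints *)

Theorem theorem1 (R : realType) (n m u v d : nat)
    (hd : (1 <= d)%N) (huv : (u + v < m - 1)%N)
    (w : nat -> R) (p : nat -> 'rV[R]_d)
    (hw : forall i : nat, (i <= n)%N -> 0 < w i)
    (q qt : nat -> 'rV[R]_d)
    (hq0 : forall r : nat, (r <= u)%N ->
      q r = (w 0%N * 'C(m, r)%:R)^-1 *:
        ('C(n, r)%:R *: fdiff r (fun i => w i *: p i) 0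
         - \sum_(0 <= i < r)
             ((-1) ^+ (r + i) * 'C(m + n, r)%:R * 'C(r, i)%:R)
               *: prodC m n w q i
         - \sum_(r - n <= i < r)
             ('C(m, i)%:R * 'C(n, r - i)%:R * w (r - i)%N) *: q i))
    (hq1 : forall s : nat, (s <= v)%N ->
      q (m - s)%N = ((-1) ^+ s / (w n * 'C(m, s)%:R)) *:
        ('C(n, s)%:R *: fdiff s (fun i => w i *: p i) (n - s)
         - \sum_(1 <= i < s.+1)
             ((-1) ^+ (s + i) * 'C(m + n, s)%:R * 'C(s, i)%:R)
               *: prodC m n w q (m + n - s + i)
         - \sum_(1 <= i < (minn s n).+1)
             ((-1) ^+ s * 'C(m, s - i)%:R * 'C(n, i)%:R * w (n - i)%N)
               *: q (m - s + i)%N)) :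
  Cuv_continuity u v (rational_bezier n w p) (bernstein_jacobi m u v q qt).
Proof.
set P := fun i => w i *: p i in hq0 hq1 *.
have w0 : w 0%N != 0 by rewrite gt_eqF ?hw.
have wn : w n != 0 by rewrite gt_eqF ?hw.
set W := \sum_(0 <= i < n.+1) w i *: bernp R n i.
set Y := bernstein_jacobi_row m u v q qt.
have W0 : W.[0] = w 0%N.
  rewrite horner_sum big_nat_recl //= big1 ?addr0 => [|i _].
    by rewrite hornerZ horner_bernp /bernstein bin0 expr0 subr0 expr1n !mulr1.
  by rewrite hornerZ horner_bernp /bernstein expr0n /= mulr0 mul0r mulr0.
have W1 : W.[1] = w n.
  rewrite horner_sum big_nat_recr //= big_nat_cond big1 ?add0r => [|i].
    by rewrite hornerZ horner_bernp /bernstein binn subnn expr0 expr1n !mulr1.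
  move=> /andP[/andP[_ lt_in] _]; rewrite hornerZ horner_bernp /bernstein subrr.
  by rewrite expr0n subn_eq0 leqNgt lt_in /= !mulr0.
(* Inserting W B, with B the Bernstein row of [q], splits the difference: Y - B is divisible for any
   Jacobi points, and the recursions govern W B - P. *)
have crossE j : cross (bezier_row n P, W) (Y, 1) 0 j =
    - (W * (Y 0 j - bezier_row m q 0 j)
       + (bezier_row (m + n) (prodC m n w q) 0 j - bezier_row n P 0 j)).
  by rewrite -bezier_row_prodC -/W !(mxE _ _ 0 j) /=; ring.
rewrite rational_bezier_ratfun bernstein_jacobi_ratfun -/P -/W -/Y.
split => [r ru|s sv]; apply: ratfun_contact; rewrite ?hornerC ?oner_neq0 ?W0 ?W1 // => j;
  rewrite crossE dvdpNr; apply: dvdp_add.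
- apply: dvdp_mull; apply: dvdp_trans (dvdp_bernstein_jacobi_row _ _ _ huv).
  by rewrite subr0; apply: dvdp_mulr; exact: dvdp_exp2l.
- rewrite subr0; apply: dvdp_bezier_row0 => k kr.
  by apply: prodC_fdiff_left => //; [lia|apply: hq0; lia].
- apply: dvdp_mull; apply: dvdp_trans (dvdp_bernstein_jacobi_row _ _ _ huv).
  apply: dvdp_mull; apply: dvdp_trans (dvdp_XB1_1BX _ _).
  exact: dvdp_exp2l.
- apply: dvdp_trans (dvdp_XB1_1BX _ _) _; apply: dvdp_bezier_row1 => k ks.
  by apply: prodC_fdiff_right => //; [lia|apply: hq1; lia].
Qed.
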